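(* Let $0\le R\le 1/3$ and let $\varphi\colon \mathcal{B}\times[0,1/3]\to[0,\infty)$ be a function such that the following conditions hold: (i) $\varphi(f,r)\le \varphi(\phi_{|a_0|},r)$ for each $0\le r\le 1/3$ and every $f(z)=\sum_{n=0}^\infty a_nz^n\in\mathcal{B}$; (ii) $$\inf_{0\le a\le 1,\ 0\le s\le R}\frac{\Upsilon(\phi_a,s)}{\varphi(\phi_a,s)}\ \le\ \inf_{0\le s\le R}\Bigg(\inf_{0\le a\le s}\bigg(1-a-s\frac{\sqrt{1-a^2}}{\sqrt{1-s^2}}\bigg)\frac{1}{\varphi(\phi_a,s)}\Bigg).$$ Then the sharp constant of $\varphi$ at $R$ is given by $$\Lambda_\varphi(R)=\inf_{0\le a\le 1,\ 0\le r\le R}\frac{\Upsilon(\phi_a,r)}{\varphi(\phi_a,r)}.$$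
   Context: $\mathbb{D}$ is the open unit disc of $\mathbb{C}$ and $\mathcal{B}$ is the class of all holomorphic functions $f\colon\mathbb{D}\to\mathbb{C}$, $f(z)=\sum_{n=0}^\infty a_n z^n$, with $|f(z)|\le 1$ for every $z\in\mathbb{D}$. For $f\in\mathcal{B}$ with Taylor coefficients $a_n$ and $0\le r\le 1/3$, set $\Upsilon(f,r)=1-\sum_{n=0}^\infty |a_n|r^n$ (by Bohr's inequality $\Upsilon(f,r)\ge 0$). For $0\le a\le 1$, $\phi_a(z)=\dfrac{z-a}{1-az}$ for $z\in\mathbb{D}$ (so $\phi_1$ is the constant function $-1$); $\phi_a\in\mathcal{B}$. For $\varphi\colon\mathcal{B}\times[0,1/3]\to[0,\infty)$ and $0\le R\le 1/3$, the sharp constant is $$\Lambda_\varphi(R)=\sup\Big\{\lambda\ge 0:\ \sum_{n=0}^\infty|a_n|r^n+\lambda\,\varphi(f,r)\le 1 \text{ for all } f=\sum_{n}a_nz^n\in\mathcal{B} \text{ and all } 0\le r\le R\Big\}\in[0,+\infty].$$ Convention: any quotient whose denominator $\varphi(\cdot,\cdot)$ equals $0$ is interpreted as $+\infty$ (also when the numerator is $0$). *)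

(* Defs.v *)
From Stdlib Require Import Reals Lra ClassicalEpsilon FunctionalExtensionality.
From Coquelicot Require Import Coquelicot.
Local Open Scope R_scope.

Definition unit_disc : Type := {z : C | Cmod z < 1}.

(* The value off the disc is irrelevant: the disc is open, so complex
   differentiability of [extend f] at a point of the disc only depends on [f]. *)
Definition extend (f : unit_disc -> C) (z : C) : C :=
  match Rlt_dec (Cmod z) 1 with
  | left h => f (exist _ z h)
  | right _ => RtoC 0
  end.

Definition holomorphic (f : unit_disc -> C) : Prop :=
  forall z : C, Cmod z < 1 -> ex_derive (K := C_AbsRing) (V := C_NormedModule) (extend f) z.

Definition Bclass (f : unit_disc -> C) : Prop :=
  holomorphic f /\ forall z : unit_disc, Cmod (f z) <= 1.

(* f(z) = sum_n a_n z^n on the whole disc. *)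
Definition taylor (f : unit_disc -> C) (a : nat -> C) : Prop :=
  forall z : unit_disc, is_pseries (K := C_AbsRing) (V := C_NormedModule) a (proj1_sig z) (f z).

(* The Taylor coefficients of f, well defined by [taylor_unique] below
   (see [taylor_coefE]). *)
Definition taylor_coef (f : unit_disc -> C) : nat -> C :=
  epsilon (inhabits (fun _ : nat => RtoC 0)) (taylor f).

Definition majorant (a : nat -> C) (r : R) : R :=
  Series (fun n => Cmod (a n) * r ^ n).

Definition Upsilon (f : unit_disc -> C) (r : R) : R := 1 - majorant (taylor_coef f) r.

Definition phi (a : R) (z : unit_disc) : C :=
  ((proj1_sig z - RtoC a) / (RtoC 1 - RtoC a * proj1_sig z))%C.

(* The quotient x / y, read as +oo whenever y = 0 (even if x = 0). *)
Definition quot (x y : R) : Rbar :=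
  if Req_EM_T y 0 then p_infty else Finite (x / y).

(* A function B x [0,1/3] -> [0,+oo) is given by [vphi : (unit_disc -> C) -> R -> R],
   of which only the values on B x [0,1/3] are ever used. *)
Definition nonneg_functional (vphi : (unit_disc -> C) -> R -> R) : Prop :=
  forall (f : unit_disc -> C) (r : R), Bclass f -> 0 <= r <= 1 / 3 -> 0 <= vphi f r.

Definition Lambda (vphi : (unit_disc -> C) -> R -> R) (R0 : R) : Rbar :=
  Lub_Rbar (fun lam : R =>
    0 <= lam /\
    forall (f : unit_disc -> C) (a : nat -> C) (r : R),
      Bclass f -> taylor f a -> 0 <= r <= R0 ->
      majorant a r + lam * vphi f r <= 1).

Definition inf_Upsilon (vphi : (unit_disc -> C) -> R -> R) (R0 : R) : Rbar :=
  Rbar_glb (fun x : Rbar =>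
    exists a s : R, 0 <= a <= 1 /\ 0 <= s <= R0 /\
      x = quot (Upsilon (phi a) s) (vphi (phi a) s)).

Definition inf_small (vphi : (unit_disc -> C) -> R -> R) (R0 : R) : Rbar :=
  Rbar_glb (fun x : Rbar =>
    exists s : R, 0 <= s <= R0 /\
      x = Rbar_glb (fun y : Rbar =>
            exists a : R, 0 <= a <= s /\
              y = quot (1 - a - s * (sqrt (1 - a ^ 2) / sqrt (1 - s ^ 2)))
                       (vphi (phi a) s))).

Lemma is_series_re_im (u : nat -> C) (l : C) :
  is_series (K := C_AbsRing) (V := C_NormedModule) u l ->
  is_series (fun n => Re (u n)) (Re l) /\ is_series (fun n => Im (u n)) (Im l).
Proof.
  intros H.
  assert (E : forall n,
    sum_n (G := NormedModule.AbelianMonoid _ R_NormedModule) (fun n => Re (u n)) n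
      = Re (sum_n (G := NormedModule.AbelianMonoid _ C_NormedModule) u n) /\
    sum_n (G := NormedModule.AbelianMonoid _ R_NormedModule) (fun n => Im (u n)) n
      = Im (sum_n (G := NormedModule.AbelianMonoid _ C_NormedModule) u n)).
  { induction n as [|n [IH1 IH2]].
    - rewrite !sum_O. now split.
    - rewrite !sum_Sn, IH1, IH2. now split. }
  split; apply filterlim_locally; intros eps;
    assert (H' := proj1 (filterlim_locally _ _) H eps);
    revert H'; apply filter_imp; intros n [H1 H2].
  - rewrite (proj1 (E n)). exact H1.
  - rewrite (proj2 (E n)). exact H2.
Qed.

Lemma pseries_coef_eq (a b : nat -> R) (g : R -> R) (n : nat) :
  (forall x, Rabs x < 1 -> is_pseries a x (g x)) ->
  (forall x, Rabs x < 1 -> is_pseries b x (g x)) -> a n = b n.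
Proof.
  intros Ha Hb.
  assert (P : forall c, (forall x, Rabs x < 1 -> is_pseries c x (g x)) ->
                        Rbar_lt 0 (CV_radius c)).
  { intros c Hc.
    destruct (Rbar_lt_le_dec 0 (CV_radius c)) as [h|h]; [exact h|].
    exfalso. apply (CV_disk_outside c (1 / 2)).
    - apply Rbar_le_lt_trans with 0; [exact h|].
      simpl. rewrite Rabs_right; lra.
    - apply (is_lim_seq_ext (fun n => scal (pow_n (1 / 2) n) (c n))).
      + intros k. rewrite pow_n_pow. unfold scal; simpl; unfold mult; simpl. ring.
      + apply ex_series_lim_0. exists (g (1 / 2)). apply Hc.
        rewrite Rabs_right; lra. }
  apply PSeries_ext_recip; [now apply P | now apply P |].
  exists (mkposreal 1 Rlt_0_1). intros x Hx.
  assert (Hx' : Rabs x < 1).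
  { unfold ball in Hx; simpl in Hx; unfold AbsRing_ball, abs, minus, plus, opp in Hx;
      simpl in Hx. replace x with (x + - 0) by ring. exact Hx. }
  rewrite (is_pseries_unique _ _ _ (Ha x Hx')), (is_pseries_unique _ _ _ (Hb x Hx')).
  reflexivity.
Qed.

Lemma taylor_re_im (f : unit_disc -> C) (a : nat -> C) : taylor f a ->
  forall x : R, Rabs x < 1 ->
    is_pseries (fun n => Re (a n)) x (Re (extend f (RtoC x))) /\
    is_pseries (fun n => Im (a n)) x (Im (extend f (RtoC x))).
Proof.
  intros Ha x Hx. unfold extend.
  destruct (Rlt_dec (Cmod (RtoC x)) 1) as [h|h];
    [| exfalso; apply h; now rewrite Cmod_R].
  assert (Hs := is_series_re_im _ _ (Ha (exist _ (RtoC x) h))).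
  assert (E : forall n, pow_n (K := C_AbsRing) (RtoC x) n = RtoC (x ^ n)).
  { induction n as [|n IH]; [reflexivity|].
    simpl. rewrite IH. symmetry. apply RtoC_mult. }
  assert (E1 : forall (t : R) (c : C),
     Re (scal (K := C_AbsRing) (V := C_NormedModule) (RtoC t) c) = t * Re c /\
     Im (scal (K := C_AbsRing) (V := C_NormedModule) (RtoC t) c) = t * Im c).
  { intros t [u v]. unfold scal; simpl; unfold mult; simpl; unfold Re, Im; simpl.
    split; ring. }
  split; [generalize (proj1 Hs) | generalize (proj2 Hs)]; apply is_series_ext;
    intros n; simpl proj1_sig; rewrite pow_n_pow, (E n);
    [exact (proj1 (E1 _ _)) | exact (proj2 (E1 _ _))].
Qed.

Lemma taylor_unique (f : unit_disc -> C) (a b : nat -> C) :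
  taylor f a -> taylor f b -> a = b.
Proof.
  intros Ha Hb. apply functional_extensionality; intros n.
  rewrite (surjective_pairing (a n)), (surjective_pairing (b n)).
  change (fst (a n)) with (Re (a n)); change (snd (a n)) with (Im (a n)).
  change (fst (b n)) with (Re (b n)); change (snd (b n)) with (Im (b n)).
  f_equal.
  - apply (pseries_coef_eq (fun n => Re (a n)) (fun n => Re (b n))
             (fun x => Re (extend f (RtoC x)))); intros x Hx;
      [apply (taylor_re_im f a) | apply (taylor_re_im f b)]; assumption.
  - apply (pseries_coef_eq (fun n => Im (a n)) (fun n => Im (b n))
             (fun x => Im (extend f (RtoC x)))); intros x Hx;
      [apply (taylor_re_im f a) | apply (taylor_re_im f b)]; assumption.
Qed.

Lemma taylor_coefE (f : unit_disc -> C) (a : nat -> C) : taylor f a -> taylor_coef f = a.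
Proof.
  intros Ha. apply taylor_unique with f; [| exact Ha].
  unfold taylor_coef. apply epsilon_spec. now exists a.
Qed.

(* Main.v *)
(** Write [a = |a_0|], [c = 1 - a^2]. Since [|f (alpha + beta z^n)| <= |alpha + beta z^n|],
    Parseval on circles of radius [t -> 1] gives
    [sum_(m <= n) |coef_m (f (alpha + beta z^n))|^2 <= |alpha|^2 + |beta|^2].
    With [beta = 0] this is [sum |a_m|^2 <= 1]; with [alpha = c], [beta = conj(a_0) a_n] it is
    Rogosinski's inequality [|a_n|^2 + c sum_(1 <= k < n) |a_k|^2 <= c^2], whence
    [sum_(k >= 1) |a_k|^2 rho^k <= rho c^2 / (1 - a^2 rho)] for [0 <= rho <= 1].
    By Cauchy-Schwarz the first bounds [sum_(k >= 1) |a_k| r^k] by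
    [r sqrt(1 - a^2) / sqrt(1 - r^2)], and the second, at [rho = r / a], by
    [c r / (1 - a r)] when [r < a], the value attained by [phi a]. So for [r < a] the
    function [phi a] is extremal by (i), and for [a <= r] condition (ii) applies. *)

Require Import Defs.
From Stdlib Require Import Reals Lra Lia.
From Coquelicot Require Import Coquelicot.
Local Open Scope R_scope.

(** * Parseval for power series on the disc *)

(** The monoid structure is pinned to that of [C_NormedModule], the one in which [is_pseries] states
    convergence, so that [change] can pass to plain complex arithmetic. *)
Definition Csum (u : nat -> C) (n : nat) : C :=
  sum_n (G := NormedModule.AbelianMonoid _ C_NormedModule) u n.

Lemma Csum_0 (u : nat -> C) : Csum u 0 = u 0%nat.
Proof. exact (sum_O u). Qed.

Lemma Csum_S (u : nat -> C) (n : nat) : Csum u (S n) = (Csum u n + u (S n))%C.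
Proof. exact (sum_Sn u n). Qed.

Lemma Csum_ext (u v : nat -> C) (n : nat) :
  (forall k, u k = v k) -> Csum u n = Csum v n.
Proof. intros H. apply sum_n_ext. exact H. Qed.

Lemma Cmod_Csum_le (u : nat -> C) (n : nat) :
  Cmod (Csum u n) <= sum_f_R0 (fun k => Cmod (u k)) n.
Proof.
  induction n as [|n IH].
  - rewrite Csum_0. simpl. lra.
  - rewrite Csum_S. simpl. eapply Rle_trans; [apply Cmod_triangle|]. lra.
Qed.

(** * Orthogonality at equally spaced points of the circle *)

Lemma Cmod2_plus (x y : C) :
  Cmod (x + y) ^ 2 = Cmod x ^ 2 + Cmod y ^ 2 + 2 * Re (x * Cconj y).
Proof. rewrite !Cmod2_alt. destruct x, y; unfold Re, Im; simpl; ring. Qed.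

(** The real form of the vanishing of a sum of powers of a root of unity. With
    [x = 2 * PI * d / (K + 1)], multiplying by [2 * sin (x / 2)] makes the sum telescope, and the
    two ends agree by periodicity. *)
Lemma sum_trig_zero (A B : R) (K d : nat) : (0 < d <= K)%nat ->
  sum_f_R0 (fun j => A * cos (INR d * (INR j * (2 * PI / INR (S K))))
                   + B * sin (INR d * (INR j * (2 * PI / INR (S K))))) K = 0.
Proof.
  intros Hd.
  set (x := INR d * (2 * PI / INR (S K))).
  assert (HK : 0 < INR (S K)) by (apply lt_0_INR; lia).
  assert (Hd0 : 0 < INR d) by (apply lt_0_INR; lia).
  assert (HdK : INR d < INR (S K)) by (apply lt_INR; lia).
  assert (HP := PI_RGT_0).
  (* Since [0 < d < K + 1], the angle [x / 2] lies strictly between [0] and [PI]. *)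
  assert (Hs : 0 < sin (x / 2)).
  { assert (E : x / 2 = PI * (INR d / INR (S K))) by (unfold x; field; lra).
    assert (0 < INR d / INR (S K) < 1).
    { split; [now apply Rdiv_lt_0_compat|].
      apply Rmult_lt_reg_r with (INR (S K)); [lra|].
      unfold Rdiv. rewrite Rmult_assoc, Rinv_l; lra. }
    apply sin_gt_0; rewrite E; nra. }
  assert (T : forall n,
    2 * sin (x / 2) * sum_f_R0 (fun j => A * cos (INR d * (INR j * (2 * PI / INR (S K))))
                   + B * sin (INR d * (INR j * (2 * PI / INR (S K))))) n
    = A * (sin (INR (S n) * x - x / 2) + sin (x / 2))
    + B * (cos (x / 2) - cos (INR (S n) * x - x / 2))).
  { assert (St : forall j,
      2 * sin (x / 2) * (A * cos (INR d * (INR j * (2 * PI / INR (S K))))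
                   + B * sin (INR d * (INR j * (2 * PI / INR (S K)))))
      = A * (sin (INR (S j) * x - x / 2) - sin (INR j * x - x / 2))
      + B * (cos (INR j * x - x / 2) - cos (INR (S j) * x - x / 2))).
    { intros j.
      replace (INR d * (INR j * (2 * PI / INR (S K)))) with (INR j * x)
        by (unfold x; field; lra).
      replace (INR (S j) * x - x / 2) with (INR j * x + x / 2)
        by (rewrite S_INR; field).
      rewrite sin_plus, cos_plus, sin_minus, cos_minus. ring. }
    induction n as [|n IH].
    - cbn [sum_f_R0]. rewrite St.
      replace (INR 0 * x - x / 2) with (- (x / 2)) by (simpl; ring).
      rewrite sin_neg, cos_neg. ring.
    - rewrite tech5, Rmult_plus_distr_l, IH, St. ring. }
  specialize (T K).
  (* [S K] steps of length [x] make exactly [d] full turns. *)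
  replace (INR (S K) * x - x / 2) with (- (x / 2) + 2 * INR d * PI) in T
    by (unfold x; field; lra).
  rewrite sin_period, cos_period, sin_neg, cos_neg in T.
  apply Rmult_eq_reg_l with (2 * sin (x / 2)); [|lra].
  rewrite T. ring.
Qed.

Definition cis (x : R) : C := (cos x, sin x).

Lemma Cmod_cis (x : R) : Cmod (cis x) = 1.
Proof.
  unfold Cmod, cis; simpl. rewrite <- sqrt_1 at 3. f_equal.
  generalize (sin2_cos2 x). unfold Rsqr. lra.
Qed.

Lemma cis_pow (x : R) (n : nat) : (cis x ^ n)%C = cis (INR n * x).
Proof.
  induction n as [|n IH].
  - unfold cis. simpl. rewrite Rmult_0_l, cos_0, sin_0. reflexivity.
  - rewrite Cpow_S, IH, S_INR.
    replace ((INR n + 1) * x) with (x + INR n * x) by ring.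
    unfold cis. rewrite cos_plus, sin_plus. unfold Cmult; simpl. f_equal; ring.
Qed.

(** For each [m <= D], the product of the monomial of degree [m] with the conjugate of the one of
    degree [N] has frequency [N - m], between [1] and [K], so [sum_trig_zero] kills it. *)
Lemma cross_term_zero (u : nat -> C) (v : C) (D N K : nat) : (D < N <= K)%nat ->
  sum_f_R0 (fun j => Re (Csum (fun m => u m * cis (INR m * (INR j * (2 * PI / INR (S K)))))%C D
       * Cconj (v * cis (INR N * (INR j * (2 * PI / INR (S K))))))%C) K = 0.
Proof.
  intros H.
  assert (One : forall m, (m < N)%nat ->
    sum_f_R0 (fun j => Re ((u m * cis (INR m * (INR j * (2 * PI / INR (S K)))))
       * Cconj (v * cis (INR N * (INR j * (2 * PI / INR (S K))))))%C) K = 0).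
  { intros m Hm.
    rewrite <- (sum_trig_zero (Re (u m * Cconj v)) (Im (u m * Cconj v)) K (N - m)) by lia.
    apply sum_eq. intros j _.
    rewrite minus_INR, Rmult_minus_distr_r by lia.
    rewrite cos_minus, sin_minus.
    destruct (u m), v. unfold cis, Re, Im; simpl. ring. }
  induction D as [|D IH].
  - erewrite sum_eq; [apply (One 0%nat); lia|].
    intros j _. cbv beta. rewrite Csum_0. reflexivity.
  - rewrite <- (Rplus_0_r 0). rewrite <- IH at 1 by lia. rewrite <- (One (S D)) by lia.
    rewrite <- plus_sum. apply sum_eq. intros j _. rewrite Csum_S.
    match goal with |- Re ((?a + ?b) * ?c)%C = _ => 
      replace ((a + b) * c)%C with (a * c + b * c)%C by ring end.
    reflexivity.
Qed.

(** An average over [K + 1] equally spaced points replaces the integral over the circle; it is exact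
    because there are more points than the degree. The induction adds one top monomial at a time,
    orthogonal to the previous ones. *)
Lemma discrete_parseval (u : nat -> C) (D K : nat) : (D <= K)%nat ->
  sum_f_R0 (fun j =>
    Cmod (Csum (fun m => u m * cis (INR m * (INR j * (2 * PI / INR (S K)))))%C D) ^ 2) K
  = INR (S K) * sum_f_R0 (fun m => Cmod (u m) ^ 2) D.
Proof.
  assert (One : forall m (x : R), Cmod (u m * cis x)%C = Cmod (u m)).
  { intros m x. rewrite Cmod_mult, Cmod_cis. ring. }
  induction D as [|D IH]; intros H.
  - rewrite (sum_eq _ (fun _ => Cmod (u 0%nat) ^ 2)).
    + rewrite sum_cte. simpl sum_f_R0. ring.
    + intros j _. rewrite Csum_0, One. reflexivity.
  - rewrite (sum_eq _ (fun j =>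
      (Cmod (Csum (fun m => u m * cis (INR m * (INR j * (2 * PI / INR (S K)))))%C D) ^ 2
       + Cmod (u (S D)) ^ 2)
      + Re (Csum (fun m => u m * cis (INR m * (INR j * (2 * PI / INR (S K)))))%C D
       * Cconj (u (S D) * cis (INR (S D) * (INR j * (2 * PI / INR (S K))))))%C * 2)).
    + rewrite plus_sum, plus_sum, IH, sum_cte by lia.
      rewrite <- scal_sum, cross_term_zero by lia. rewrite tech5. ring.
    + intros j _. rewrite Csum_S, Cmod2_plus, One. ring.
Qed.

(** * Absolute and uniform convergence on circles inside the disc *)

Lemma pow_n_Cpow (z : C) (n : nat) : pow_n (K := C_AbsRing) z n = (z ^ n)%C.
Proof. induction n as [|n IH]; [reflexivity|]. simpl. rewrite IH. reflexivity. Qed.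

Lemma taylor_ex_series (f : unit_disc -> C) (a : nat -> C) (t : R) :
  taylor f a -> 0 <= t < 1 -> ex_series (fun n => Cmod (a n) * t ^ n).
Proof.
  intros Ha Ht.
  assert (P : forall b : nat -> R,
     (forall x, Rabs x < 1 -> ex_pseries b x) -> ex_series (fun n => Rabs (b n * t ^ n))).
  { intros b Hb. apply CV_disk_inside.
    (* Convergence at this point between [t] and [1] makes the terms tend to [0] there, so the
       radius of convergence is at least [x > t]. *)
    set (x := (1 + t) / 2).
    assert (Hx : Rabs x = x) by (apply Rabs_right; unfold x; lra).
    apply Rbar_lt_le_trans with x;
      [simpl; rewrite Rabs_right; unfold x; lra|].
    destruct (Rbar_le_lt_dec x (CV_radius b)) as [h|h]; [exact h|].
    exfalso. apply (CV_disk_outside b x); [now rewrite Hx|].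
    apply (is_lim_seq_ext (fun n => scal (pow_n x n) (b n))).
    - intros k. rewrite pow_n_pow. unfold scal; simpl; unfold mult; simpl. ring.
    - apply ex_series_lim_0. apply Hb. rewrite Hx. unfold x; lra. }
  assert (HR := P (fun n => Re (a n)) (fun x Hx => ex_intro _ _ (proj1 (taylor_re_im f a Ha x Hx)))).
  assert (HI := P (fun n => Im (a n)) (fun x Hx => ex_intro _ _ (proj2 (taylor_re_im f a Ha x Hx)))).
  apply (@ex_series_le R_AbsRing R_CompleteNormedModule) with (2 := ex_series_plus _ _ HR HI).
  intros n. change (Rabs (Cmod (a n) * t ^ n) <= Rabs (Re (a n) * t ^ n) + Rabs (Im (a n) * t ^ n)).
  assert (0 <= t ^ n) by (apply pow_le; lra).
  rewrite !Rabs_mult, (Rabs_right (t ^ n)), (Rabs_right (Cmod _)) by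
    (apply Rle_ge; [assumption || apply Cmod_ge_0]).
  rewrite <- Rmult_plus_distr_r. apply Rmult_le_compat_r; [assumption|].
  replace (a n) with (RtoC (Re (a n)) + Ci * RtoC (Im (a n)))%C at 1
    by (destruct (a n); unfold Ci, RtoC, Re, Im, Cplus, Cmult; simpl; f_equal; ring).
  eapply Rle_trans; [apply Cmod_triangle|].
  rewrite Cmod_mult, !Cmod_R, Cmod_Ci. lra.
Qed.

Lemma Csum_dist_le (u : nat -> C) (n k : nat) :
  Cmod (Csum u (n + k) - Csum u n) <=
  sum_f_R0 (fun m => Cmod (u m)) (n + k) - sum_f_R0 (fun m => Cmod (u m)) n.
Proof.
  induction k as [|k IH].
  - rewrite Nat.add_0_r. unfold Cminus. rewrite Cplus_opp_r, Cmod_0. lra.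
  - rewrite Nat.add_succ_r, Csum_S, tech5.
    replace (Csum u (n + k) + u (S (n + k)) - Csum u n)%C
      with ((Csum u (n + k) - Csum u n) + u (S (n + k)))%C by ring.
    eapply Rle_trans; [apply Cmod_triangle|]. lra.
Qed.

Lemma sum_f_R0_le_Series (u : nat -> R) (n : nat) :
  (forall k, 0 <= u k) -> ex_series u -> sum_f_R0 u n <= Series u.
Proof.
  intros Hu He. rewrite <- sum_n_Reals.
  assert (L := Series_correct _ He).
  apply (is_lim_seq_incr_compare _ _ L).
  intros k. rewrite sum_Sn. unfold plus; simpl. specialize (Hu (S k)). lra.
Qed.

(** On the circle of radius [t], the tail is dominated by that of [Cmod (a n) * t ^ n], which does
    not depend on [z]. The clause [n <= M] later guarantees enough sample points for a comparison
    polynomial of degree [n]. *)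
Lemma taylor_uniform (f : unit_disc -> C) (a : nat -> C) (t eps : R) (n : nat) :
  taylor f a -> 0 <= t < 1 -> 0 < eps ->
  exists M, (n <= M)%nat /\ forall z : unit_disc, Cmod (proj1_sig z) = t ->
    Cmod (Csum (fun m => a m * proj1_sig z ^ m)%C M - f z) <= eps.
Proof.
  intros Ha Ht Heps.
  assert (He := taylor_ex_series f a t Ha Ht).
  assert (Hp : forall k, 0 <= Cmod (a k) * t ^ k).
  { intros k. apply Rmult_le_pos; [apply Cmod_ge_0|]. apply pow_le; lra. }
  assert (L : is_lim_seq (sum_n (fun n => Cmod (a n) * t ^ n))
                (Series (fun n => Cmod (a n) * t ^ n))) by exact (Series_correct _ He).
  apply is_lim_seq_spec in L.
  destruct (L (mkposreal (eps / 2) ltac:(lra))) as [N HN]. simpl in HN.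
  exists (max n N). split; [lia|]. intros z Hz.
  specialize (HN (max n N) ltac:(lia)). rewrite sum_n_Reals in HN.
  assert (Hf := Ha z).
  assert (Hf' := proj1 (filterlim_locally_ball_norm _ _) Hf (mkposreal (eps / 2) ltac:(lra))).
  (* [L'] depends on [z], but only the intermediate partial sum up to [M + L'] uses it; [M] was
     fixed before [z]. *)
  destruct Hf' as [L' HL].
  set (M := max n N) in *.
  specialize (HL (M + L')%nat ltac:(lia)).
  change (Cmod (Csum (fun k => pow_n (K := C_AbsRing) (proj1_sig z) k * a k)%C (M + L') - f z)
          < eps / 2) in HL.
  rewrite (Csum_ext _ (fun m => a m * proj1_sig z ^ m)%C) in HL
    by (intros k; rewrite pow_n_Cpow; apply Cmult_comm).
  set (u := fun m => (a m * proj1_sig z ^ m)%C) in *.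
  assert (D := Csum_dist_le u M L').
  assert (Q : forall j, sum_f_R0 (fun m => Cmod (u m)) j = sum_f_R0 (fun k => Cmod (a k) * t ^ k) j).
  { intros j. apply sum_eq. intros k _. unfold u. now rewrite Cmod_mult, Cmod_pow, Hz. }
  rewrite !Q in D.
  assert (B := sum_f_R0_le_Series _ (M + L') Hp He).
  apply Rabs_def2 in HN.
  replace (Csum u M - f z)%C with ((Csum u (M + L') - f z) + - (Csum u (M + L') - Csum u M))%C by ring.
  eapply Rle_trans; [apply Cmod_triangle|]. rewrite Cmod_opp. lra.
Qed.

(* Parseval on the circle |z| = t, then t -> 1. *)
Lemma parseval_majorization (g : unit_disc -> C) (c d : nat -> C) (n : nat) :
  taylor g c ->
  (forall z : unit_disc, Cmod (g z) <= Cmod (Csum (fun m => d m * proj1_sig z ^ m)%C n)) ->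
  sum_f_R0 (fun m => Cmod (c m) ^ 2) n <= sum_f_R0 (fun m => Cmod (d m) ^ 2) n.
Proof.
  intros Hc Hd.
  (* [B] bounds the comparison polynomial on the disc, so that squaring [|Y| + eps] costs at most
     [2 * B * eps + eps ^ 2]. *)
  set (B := sum_f_R0 (fun m => Cmod (d m)) n).
  assert (HB : 0 <= B) by (apply cond_pos_sum; intros; apply Cmod_ge_0).
  assert (Key : forall t eps, 0 <= t < 1 -> 0 < eps ->
    sum_f_R0 (fun m => Cmod (c m) ^ 2 * (t ^ 2) ^ m) n
      <= sum_f_R0 (fun m => Cmod (d m) ^ 2) n + (2 * B * eps + eps ^ 2)).
  { intros t eps Ht Heps.
    destruct (taylor_uniform g c t eps n Hc Ht Heps) as [M [HnM HM]].
    (* [M + 1] sample points suffice for both polynomials, of degrees [M] and [n <= M]. *)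
    set (w := fun j => (RtoC t * cis (INR j * (2 * PI / INR (S M))))%C).
    assert (Hw : forall j, Cmod (w j) = t).
    { intros j. unfold w. rewrite Cmod_mult, Cmod_cis, Cmod_R, Rabs_right; lra. }
    assert (Ev : forall (b : nat -> C) D j,
      Csum (fun m => b m * w j ^ m)%C D
      = Csum (fun m => (b m * RtoC (t ^ m)) * cis (INR m * (INR j * (2 * PI / INR (S M)))))%C D).
    { intros b D j. apply Csum_ext. intros k. unfold w.
      rewrite Cpow_mult_l, cis_pow, RtoC_pow. ring. }
    assert (Sq : forall (b : nat -> C) m,
      Cmod (b m * RtoC (t ^ m))%C ^ 2 = Cmod (b m) ^ 2 * (t ^ 2) ^ m).
    { intros b m. rewrite Cmod_mult, Cmod_R, Rpow_mult_distr, pow2_abs, <- !pow_mult, (Nat.mul_comm m). reflexivity. }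
    assert (Tle : forall m, 0 <= (t ^ 2) ^ m <= 1).
    { intros m. assert (0 <= t ^ 2 <= 1) by nra. split; [apply pow_le; lra|].
      rewrite <- (pow1 m). apply pow_incr. lra. }
    assert (Pt : forall j,
      Cmod (Csum (fun m => c m * w j ^ m)%C M) ^ 2 <=
      Cmod (Csum (fun m => d m * w j ^ m)%C n) ^ 2 + (2 * B * eps + eps ^ 2)).
    { intros j.
      assert (h : Cmod (w j) < 1) by (rewrite Hw; lra).
      set (z := exist (fun z : C => Cmod z < 1) (w j) h : unit_disc).
      assert (H1 := HM z (Hw j)). assert (H2 := Hd z). simpl in H1, H2.
      assert (H3 : Cmod (Csum (fun m => d m * w j ^ m)%C n) <= B).
      { eapply Rle_trans; [apply Cmod_Csum_le|]. apply sum_Rle. intros k _.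
        rewrite Cmod_mult, Cmod_pow, Hw.
        assert (0 <= t ^ k <= 1).
        { split; [apply pow_le; lra|]. rewrite <- (pow1 k). apply pow_incr. lra. }
        assert (H4 := Cmod_ge_0 (d k)). nra. }
      set (X := Csum (fun m => c m * w j ^ m)%C M) in *.
      set (Y := Csum (fun m => d m * w j ^ m)%C n) in *.
      assert (H5 : Cmod X <= Cmod Y + eps).
      { replace X with (g z + (X - g z))%C by ring.
        eapply Rle_trans; [apply Cmod_triangle|]. unfold z in *. lra. }
      assert (H6 := Cmod_ge_0 X). assert (H7 := Cmod_ge_0 Y). nra. }
    assert (SS := sum_Rle _ _ M (fun j _ => Pt j)).
    rewrite plus_sum, sum_cte in SS.
    rewrite (sum_eq _ _ M (fun j _ => f_equal (fun x => Cmod x ^ 2) (Ev c M j))) in SS.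
    rewrite (sum_eq (fun j => Cmod (Csum (fun m => d m * w j ^ m)%C n) ^ 2) _ M
              (fun j _ => f_equal (fun x => Cmod x ^ 2) (Ev d n j))) in SS.
    rewrite !discrete_parseval in SS by lia.
    assert (HMp : 0 < INR (S M)) by (apply lt_0_INR; lia).
    assert (SS' : sum_f_R0 (fun m => Cmod (c m * RtoC (t ^ m))%C ^ 2) M
        <= sum_f_R0 (fun m => Cmod (d m * RtoC (t ^ m))%C ^ 2) n + (2 * B * eps + eps ^ 2)) by nra.
    rewrite (sum_eq _ _ M (fun m _ => Sq c m)), (sum_eq _ _ n (fun m _ => Sq d m)) in SS'.
    eapply Rle_trans; [|eapply Rle_trans; [exact SS'|]].
    - replace M with (n + (M - n))%nat by lia. generalize (M - n)%nat. intros k.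
      induction k as [|k IH]; [rewrite Nat.add_0_r; lra|].
      rewrite Nat.add_succ_r, tech5.
      assert (0 <= Cmod (c (S (n + k))) ^ 2 * (t ^ 2) ^ S (n + k)); [|lra].
      apply Rmult_le_pos; [apply pow2_ge_0|apply Tle].
    - apply Rplus_le_compat_r. apply sum_Rle. intros m _.
      assert (H := Tle m). assert (H' := pow2_ge_0 (Cmod (d m))). nra. }
  (* Here [eps] goes to [0] at a fixed radius, with [y] standing for [t ^ 2]. *)
  assert (Key2 : forall y, 0 <= y < 1 ->
    sum_f_R0 (fun m => Cmod (c m) ^ 2 * y ^ m) n <= sum_f_R0 (fun m => Cmod (d m) ^ 2) n).
  { intros y Hy. apply Rnot_lt_le. intros Hlt.
    set (del := sum_f_R0 (fun m => Cmod (c m) ^ 2 * y ^ m) n - sum_f_R0 (fun m => Cmod (d m) ^ 2) n).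
    assert (Hdel : 0 < del) by (unfold del; lra).
    (* With [eps <= 1] the error is at most [(2 * B + 1) * eps <= del / 2]. *)
    set (eps := Rmin 1 (del / (2 * (2 * B + 1)))).
    assert (He : 0 < eps).
    { unfold eps. apply Rmin_glb_lt; [lra|]. apply Rdiv_lt_0_compat; lra. }
    assert (He1 : eps <= 1) by apply Rmin_l.
    assert (He2 : eps * (2 * (2 * B + 1)) <= del).
    { apply Rle_trans with (del / (2 * (2 * B + 1)) * (2 * (2 * B + 1))).
      - apply Rmult_le_compat_r; [lra|apply Rmin_r].
      - right. field. lra. }
    assert (Hs : 0 <= sqrt y < 1).
    { split; [apply sqrt_pos|]. rewrite <- sqrt_1. apply sqrt_lt_1; lra. }
    assert (H := Key (sqrt y) eps Hs He).
    rewrite pow2_sqrt in H by lra. unfold del in He2. nra. }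
  (* The limit [y -> 1] is the continuity at [1] of the finite sum [h]. *)
  apply Rnot_lt_le. intros Hlt.
  set (h := fun y => sum_f_R0 (fun m => Cmod (c m) ^ 2 * y ^ m) n).
  assert (E1 : h 1 = sum_f_R0 (fun m => Cmod (c m) ^ 2) n).
  { apply sum_eq. intros m _. rewrite pow1. ring. }
  assert (Hcont := continuity_finite_sum (fun m => Cmod (c m) ^ 2) n 1).
  change (continuity_pt h 1) in Hcont.
  destruct (Hcont (h 1 - sum_f_R0 (fun m => Cmod (d m) ^ 2) n)) as [al [Hal Hc1]]; [lra|].
  set (y := 1 - Rmin (1 / 2) (al / 2)).
  assert (Hm1 : Rmin (1 / 2) (al / 2) <= 1 / 2) by apply Rmin_l.
  assert (Hm2 : Rmin (1 / 2) (al / 2) <= al / 2) by apply Rmin_r.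
  assert (Hm3 : 0 < Rmin (1 / 2) (al / 2)) by (apply Rmin_glb_lt; lra).
  assert (Hy := Key2 y ltac:(unfold y; lra)). fold (h y) in Hy.
  specialize (Hc1 y).
  assert (Rabs (h y - h 1) < h 1 - sum_f_R0 (fun m => Cmod (d m) ^ 2) n).
  { apply Hc1. split.
    - split; [exact I|]. unfold y; lra.
    - simpl. unfold Rdist. rewrite Rabs_left; unfold y; lra. }
  apply Rabs_def2 in H. lra.
Qed.

(** * Bounds on Taylor coefficients *)

(** The multiplier has only two terms, so the product is a scaled copy plus a shifted scaled copy
    and no Cauchy product is involved. *)
Lemma taylor_mul_binomial (f : unit_disc -> C) (a : nat -> C) (al be : C) (n : nat) :
  taylor f a ->
  taylor (fun z => f z * (al + be * proj1_sig z ^ n))%C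
    (PS_plus (V := C_NormedModule) (PS_scal (V := C_NormedModule) al a)
       (PS_scal (V := C_NormedModule) be (PS_incr_n (V := C_NormedModule) a n))).
Proof.
  intros Ha z.
  replace (f z * (al + be * proj1_sig z ^ n))%C with
    (plus (G := C_NormedModule) (scal (V := C_NormedModule) al (f z))
      (scal (V := C_NormedModule) be
        (scal (V := C_NormedModule) (pow_n (K := C_AbsRing) (proj1_sig z) n) (f z)))).
  - apply is_pseries_plus; (apply is_pseries_scal; [apply Cmult_comm|]).
    + apply Ha.
    + apply is_pseries_incr_n, Ha.
  - rewrite pow_n_Cpow.
    change (al * f z + be * (proj1_sig z ^ n * f z) = f z * (al + be * proj1_sig z ^ n))%C.
    ring.
Qed.

(** As [|f| <= 1], the product of [f] with [al + be * z ^ (k + 1)] is dominated by the binomial, and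
    [parseval_majorization] applies. Below degree [k + 1] the shifted copy contributes nothing; at
    [k + 1] it contributes [be * a 0]. *)
Lemma binomial_coef_le (f : unit_disc -> C) (a : nat -> C) (al be : C) (k : nat) :
  Bclass f -> taylor f a ->
  Cmod al ^ 2 * sum_f_R0 (fun m => Cmod (a m) ^ 2) k
    + Cmod (al * a (S k) + be * a 0%nat)%C ^ 2 <= Cmod al ^ 2 + Cmod be ^ 2.
Proof.
  intros [_ Hf] Ha.
  set (d := fun m => match m with O => al | S j => if Nat.eqb j k then be else RtoC 0 end).
  assert (Hd : forall j, (j < k)%nat -> d (S j) = RtoC 0).
  { intros j Hj. simpl. rewrite (proj2 (Nat.eqb_neq j k)) by lia. reflexivity. }
  assert (Hdk : d (S k) = be) by (simpl; now rewrite Nat.eqb_refl).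
  assert (H := parseval_majorization _ _ d (S k) (taylor_mul_binomial f a al be (S k) Ha)).
  rewrite !tech5 in H.
  assert (E1 : forall j, (j <= k)%nat -> sum_f_R0 (fun m => Cmod (d m) ^ 2) j = Cmod al ^ 2).
  { induction j as [|j IH]; intros Hj; [reflexivity|].
    rewrite tech5, IH, Hd, Cmod_0 by lia. ring. }
  assert (E2 : forall z j, (j <= k)%nat -> Csum (fun m => d m * z ^ m)%C j = al).
  { intros z. induction j as [|j IH]; intros Hj.
    - rewrite Csum_0. simpl. ring.
    - rewrite Csum_S, IH, Hd by lia. ring. }
  rewrite E1, Hdk in H by lia.
  eapply Rle_trans; [|apply H].
  - apply Req_le. f_equal.
    + rewrite scal_sum. apply sum_eq. intros m Hm.
      unfold PS_plus, PS_scal. rewrite PS_incr_n_simplify.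
      destruct (Compare_dec.le_lt_dec (S k) m) as [h|h]; [lia|].
      change (Cmod (a m) ^ 2 * Cmod al ^ 2 = Cmod (al * a m + be * 0)%C ^ 2).
      rewrite Cmult_0_r, Cplus_0_r, Cmod_mult. ring.
    + unfold PS_plus, PS_scal. rewrite PS_incr_n_simplify.
      destruct (Compare_dec.le_lt_dec (S k) (S k)) as [h|h]; [|lia].
      rewrite Nat.sub_diag. reflexivity.
  - intros z. rewrite Csum_S, E2, Hdk, Cmod_mult by lia.
    rewrite <- (Rmult_1_l (Cmod (al + _))) at 2.
    apply Rmult_le_compat_r; [apply Cmod_ge_0|apply Hf].
Qed.

Lemma sum_coef_sq_le_1 (f : unit_disc -> C) (a : nat -> C) (k : nat) :
  Bclass f -> taylor f a -> sum_f_R0 (fun m => Cmod (a m) ^ 2) (S k) <= 1.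
Proof.
  intros Hf Ha. assert (H := binomial_coef_le f a 1 0 k Hf Ha).
  rewrite Cmult_1_l, Cmult_0_l, Cplus_0_r, Cmod_1, Cmod_0 in H.
  rewrite tech5. lra.
Qed.

Lemma sum_tail (u : nat -> R) (k : nat) :
  sum_f_R0 u (S k) = u 0%nat + sum_f_R0 (fun m => u (S m)) k.
Proof. apply (decomp_sum u (S k)). lia. Qed.

Lemma Cmod_coef0_le_1 (f : unit_disc -> C) (a : nat -> C) :
  Bclass f -> taylor f a -> Cmod (a 0%nat) <= 1.
Proof.
  intros Hf Ha. assert (H := sum_coef_sq_le_1 f a 0 Hf Ha). simpl in H.
  assert (H1 := Cmod_ge_0 (a 0%nat)). assert (H2 := Cmod_ge_0 (a 1%nat)). nra.
Qed.

(* The multiplier [c + conj(a_0) a_{k+1} z^(k+1)], [c = 1 - |a_0|^2], is the optimal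
   choice in [binomial_coef_le]. *)
Lemma rogosinski (f : unit_disc -> C) (a : nat -> C) (k : nat) :
  Bclass f -> taylor f a ->
  (1 - Cmod (a 0%nat) ^ 2) * sum_f_R0 (fun m => Cmod (a (S m)) ^ 2) k
    + Cmod (a 0%nat) ^ 2 * Cmod (a (S k)) ^ 2 <= (1 - Cmod (a 0%nat) ^ 2) ^ 2.
Proof.
  intros Hf Ha.
  assert (H1 := sum_coef_sq_le_1 f a k Hf Ha).
  assert (Ha0 := Cmod_coef0_le_1 f a Hf Ha).
  assert (Ha0' := Cmod_ge_0 (a 0%nat)).
  set (c := 1 - Cmod (a 0%nat) ^ 2).
  assert (Hc : 0 <= c) by (unfold c; nra).
  assert (H2 := binomial_coef_le f a (RtoC c) (Cconj (a 0%nat) * a (S k)) k Hf Ha).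
  (* The top coefficient of the product collapses because [c + |a_0|^2 = 1]. *)
  assert (E : (RtoC c * a (S k) + Cconj (a 0%nat) * a (S k) * a 0%nat)%C = a (S k)).
  { replace (RtoC c * a (S k) + Cconj (a 0%nat) * a (S k) * a 0%nat)%C
      with ((RtoC c + a 0%nat * Cconj (a 0%nat)) * a (S k))%C by ring.
    rewrite <- Cmod2_conj, <- RtoC_plus. unfold c.
    replace (1 - Cmod (a 0%nat) ^ 2 + Cmod (a 0%nat) ^ 2) with 1 by ring. ring. }
  rewrite E, Cmod_mult, Cmod_conj, Cmod_R, (Rabs_right c) in H2 by lra.
  assert (X := tech5 (fun m => Cmod (a m) ^ 2) k).
  assert (X' := sum_tail (fun m => Cmod (a m) ^ 2) k). cbv beta in X, X'.
  set (A := sum_f_R0 (fun m => Cmod (a (S m)) ^ 2) k) in *.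
  set (XS := sum_f_R0 (fun m => Cmod (a m) ^ 2) (S k)) in *.
  set (X0 := sum_f_R0 (fun m => Cmod (a m) ^ 2) k) in *.
  set (y := Cmod (a (S k))) in *. set (x := Cmod (a 0%nat)) in *.
  assert (Hy : 0 <= y ^ 2) by apply pow2_ge_0.
  assert (Hy0 : 0 <= A - y ^ 2).
  { unfold A, y. destruct k as [|k]; [simpl; lra|]. rewrite tech5.
    assert (0 <= sum_f_R0 (fun m => Cmod (a (S m)) ^ 2) k); [|lra].
    apply cond_pos_sum. intros; apply pow2_ge_0. }
  assert (Ex : x ^ 2 = 1 - c) by (unfold c; lra).
  (* The multiplier inequality carries a spare factor [c], cancelled when [c > 0]. If [c = 0], then
     [|a_0| = 1] and Parseval leaves no room for [a (S k)]. *)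
  destruct (Rle_lt_or_eq_dec 0 c Hc) as [Hc'|Hc'].
  - apply Rmult_le_reg_l with c; [exact Hc'|]. rewrite Rpow_mult_distr, Ex in H2.
    replace A with (X0 + y ^ 2 - x ^ 2) by lra. rewrite Ex. nra.
  - assert (y ^ 2 = 0) by lra. nra.
Qed.

(* Summation by parts against the decreasing weights [rho^m]. *)
Lemma rogosinski_weighted (f : unit_disc -> C) (a : nat -> C) (rho : R) (k : nat) :
  Bclass f -> taylor f a -> 0 <= rho <= 1 ->
  (1 - Cmod (a 0%nat) ^ 2 * rho) * sum_f_R0 (fun m => Cmod (a (S m)) ^ 2 * rho ^ m) k
    <= (1 - Cmod (a 0%nat) ^ 2) ^ 2.
Proof.
  intros Hf Ha Hr.
  assert (H := fun k => rogosinski f a k Hf Ha).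
  set (x := Cmod (a 0%nat)) in *. set (c := 1 - x ^ 2) in *.
  (* The right side is the boundary term of the summation by parts; its bracket is nonpositive by
     [rogosinski]. At [k = 0] this is an equality. *)
  assert (Q : (1 - x ^ 2 * rho) * sum_f_R0 (fun m => Cmod (a (S m)) ^ 2 * rho ^ m) k - c ^ 2
    <= rho ^ k * (c * sum_f_R0 (fun m => Cmod (a (S m)) ^ 2) k - c ^ 2
                  + x ^ 2 * (1 - rho) * Cmod (a (S k)) ^ 2)).
  { induction k as [|k IH].
    - simpl. unfold c. apply Req_le. ring.
    - rewrite !tech5.
      specialize (H k).
      set (A := sum_f_R0 (fun m => Cmod (a (S m)) ^ 2) k) in *.
      set (T := sum_f_R0 (fun m => Cmod (a (S m)) ^ 2 * rho ^ m) k) in *.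
      set (y := Cmod (a (S k)) ^ 2) in *. set (y' := Cmod (a (S (S k))) ^ 2).
      simpl (rho ^ S k).
      assert (Hp : 0 <= rho ^ k) by (apply pow_le; lra).
      assert (Hp2 : 0 <= rho ^ k * (1 - rho)) by (apply Rmult_le_pos; lra).
      (* The drop [rho ^ k - rho ^ (k + 1)] of the weight multiplies a quantity that [rogosinski]
         makes nonpositive. *)
      assert (Hq : rho ^ k * (1 - rho) * (c * A + x ^ 2 * y - c ^ 2) <= 0) by nra.
      replace (rho * rho ^ k * (c * (A + y') - c ^ 2 + x ^ 2 * (1 - rho) * y'))
        with (rho ^ k * (c * A - c ^ 2 + x ^ 2 * (1 - rho) * y)
          - rho ^ k * (1 - rho) * (c * A + x ^ 2 * y - c ^ 2)
          + (1 - x ^ 2 * rho) * (y' * (rho * rho ^ k))) by (unfold c; ring).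
      lra. }
  specialize (H k).
  assert (Hp : 0 <= rho ^ k) by (apply pow_le; lra).
  assert (0 <= x ^ 2 * Cmod (a (S k)) ^ 2) by (apply Rmult_le_pos; apply pow2_ge_0).
  assert (rho ^ k * (c * sum_f_R0 (fun m => Cmod (a (S m)) ^ 2) k - c ^ 2
                  + x ^ 2 * (1 - rho) * Cmod (a (S k)) ^ 2) <= 0); [|lra].
  assert (0 <= rho * (x ^ 2 * Cmod (a (S k)) ^ 2)) by (apply Rmult_le_pos; lra).
  rewrite <- (Rmult_0_r (rho ^ k)). apply Rmult_le_compat_l; [exact Hp|]. lra.
Qed.

(** * Majorant bounds by Cauchy-Schwarz *)

Lemma cauchy_schwarz_sum (x y z : nat -> R) (n : nat) :
  (forall k, 0 <= x k) -> (forall k, 0 <= y k) -> (forall k, 0 <= z k) ->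
  (forall k, z k ^ 2 <= x k * y k) ->
  sum_f_R0 z n ^ 2 <= sum_f_R0 x n * sum_f_R0 y n.
Proof.
  intros Hx Hy Hz H. induction n as [|n IH]; [apply H|].
  rewrite !tech5.
  assert (HX : 0 <= sum_f_R0 x n) by now apply cond_pos_sum.
  assert (HY : 0 <= sum_f_R0 y n) by now apply cond_pos_sum.
  assert (HZ : 0 <= sum_f_R0 z n) by now apply cond_pos_sum.
  specialize (Hx (S n)). specialize (Hy (S n)). specialize (Hz (S n)). specialize (H (S n)).
  set (X := sum_f_R0 x n) in *. set (Y := sum_f_R0 y n) in *. set (Z := sum_f_R0 z n) in *.
  set (x' := x (S n)) in *. set (y' := y (S n)) in *. set (z' := z (S n)) in *.
  (* The arithmetic-geometric mean inequality for [X * y'] and [x' * Y], compared through squares to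
     avoid roots. *)
  assert (2 * (Z * z') <= X * y' + x' * Y).
  { apply Rsqr_incr_0_var; [|apply Rplus_le_le_0_compat; apply Rmult_le_pos; assumption].
    unfold Rsqr.
    assert (Z ^ 2 * z' ^ 2 <= (X * Y) * (x' * y')).
    { apply Rmult_le_compat; try assumption; apply pow2_ge_0. }
    assert (0 <= (X * y' - x' * Y) ^ 2) by apply pow2_ge_0. nra. }
  nra.
Qed.

Lemma sum_geom_le (q : R) (n : nat) : 0 <= q < 1 -> (1 - q) * sum_f_R0 (fun m => q ^ m) n <= 1.
Proof.
  intros Hq. rewrite (tech3 q n) by lra.
  assert (0 <= q ^ S n) by (apply pow_le; lra).
  replace ((1 - q) * ((1 - q ^ S n) / (1 - q))) with (1 - q ^ S n) by (field; lra). lra.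
Qed.

Lemma majorant_le (f : unit_disc -> C) (a : nat -> C) (r B : R) :
  taylor f a -> 0 <= r < 1 ->
  (forall k, sum_f_R0 (fun m => Cmod (a (S m)) * r ^ S m) k <= B) ->
  Defs.majorant a r <= Cmod (a 0%nat) + B.
Proof.
  intros Ha Hr HB.
  assert (L : is_lim_seq (sum_n (fun n => Cmod (a n) * r ^ n)) (Defs.majorant a r))
    by exact (Series_correct _ (taylor_ex_series f a r Ha Hr)).
  apply is_lim_seq_incr_1 in L.
  refine (is_lim_seq_le _ (fun _ => Cmod (a 0%nat) + B) (Finite _) (Finite _) _ L
            (is_lim_seq_const _)).
  intros k. rewrite sum_n_Reals, sum_tail. specialize (HB k).
  simpl (r ^ 0). lra.
Qed.

(* Bombieri's bound: Cauchy-Schwarz with [rogosinski_weighted] at [rho = r / |a_0|]. *)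
Lemma majorant_le_large_coef0 (f : unit_disc -> C) (a : nat -> C) (r : R) :
  Bclass f -> taylor f a -> 0 <= r < 1 -> r < Cmod (a 0%nat) ->
  Defs.majorant a r <= Cmod (a 0%nat)
     + (1 - Cmod (a 0%nat) ^ 2) * r / (1 - Cmod (a 0%nat) * r).
Proof.
  intros Hf Ha Hr Hra.
  assert (Hx1 := Cmod_coef0_le_1 f a Hf Ha).
  assert (W := fun k => rogosinski_weighted f a (r / Cmod (a 0%nat)) k Hf Ha).
  apply (majorant_le f); [assumption|lra|]. intros k. specialize (W k).
  set (x := Cmod (a 0%nat)) in *. set (c := 1 - x ^ 2) in *.
  assert (Hrho : r / x * x = r) by (field; lra).
  assert (Hrho01 : 0 <= r / x <= 1).
  { split; [apply Rmult_le_pos; [lra|]; left; apply Rinv_0_lt_compat; lra|].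
    apply Rmult_le_reg_r with x; lra. }
  specialize (W Hrho01).
  (* This choice of [rho] makes [1 - x ^ 2 * rho] equal to [1 - x * r], the denominator of the
     complementary geometric sum of ratio [x * r]; the product of the two bounds is then a perfect
     square. The assumption [r < x] keeps [rho] below [1]. *)
  replace (x ^ 2 * (r / x)) with (x * r) in W by (field; lra).
  assert (Hq : 0 <= x * r < 1) by nra.
  assert (G := sum_geom_le (x * r) k Hq).
  assert (Hc : 0 <= c) by (unfold c; nra).
  assert (CS := cauchy_schwarz_sum (fun m => Cmod (a (S m)) ^ 2 * (r / x) ^ m)
     (fun m => (x * r) ^ m * r ^ 2) (fun m => Cmod (a (S m)) * r ^ S m) k).
  rewrite <- (scal_sum (fun m => (x * r) ^ m)) in CS.
  set (U := sum_f_R0 (fun m => Cmod (a (S m)) ^ 2 * (r / x) ^ m) k) in *.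
  set (V := sum_f_R0 (fun m => (x * r) ^ m) k) in *.
  set (Z := sum_f_R0 (fun m => Cmod (a (S m)) * r ^ S m) k) in *.
  assert (CS' : Z ^ 2 <= U * (r ^ 2 * V)).
  { apply CS; intros m.
    - apply Rmult_le_pos; [apply pow2_ge_0|apply pow_le; lra].
    - apply Rmult_le_pos; [apply pow_le; lra|apply pow2_ge_0].
    - apply Rmult_le_pos; [apply Cmod_ge_0|apply pow_le; lra].
    - apply Req_le.
      assert (E : (r / x) ^ m * (x * r) ^ m = r ^ m * r ^ m).
      { rewrite <- !Rpow_mult_distr. f_equal. field; lra. }
      replace (Cmod (a (S m)) ^ 2 * (r / x) ^ m * ((x * r) ^ m * r ^ 2))
        with (Cmod (a (S m)) ^ 2 * ((r / x) ^ m * (x * r) ^ m) * r ^ 2) by ring.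
      rewrite E. simpl. ring. }
  assert (HV : 0 <= V) by (apply cond_pos_sum; intros; apply pow_le; lra).
  apply Rmult_le_reg_r with (1 - x * r); [lra|].
  replace (c * r / (1 - x * r) * (1 - x * r)) with (c * r) by (field; lra).
  apply Rsqr_incr_0_var; [|nra].
  rewrite !Rsqr_pow2, Rpow_mult_distr.
  apply Rle_trans with (((1 - x * r) * U) * (r ^ 2 * ((1 - x * r) * V))).
  - apply Rle_trans with (U * (r ^ 2 * V) * (1 - x * r) ^ 2); [|apply Req_le; ring].
    apply Rmult_le_compat_r; [apply pow2_ge_0|assumption].
  - rewrite Rpow_mult_distr. apply Rmult_le_compat.
    + apply Rmult_le_pos; [lra|]. apply cond_pos_sum. intros m.
      apply Rmult_le_pos; [apply pow2_ge_0|apply pow_le; lra].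
    + apply Rmult_le_pos; [apply pow2_ge_0|]. apply Rmult_le_pos; lra.
    + exact W.
    + rewrite <- (Rmult_1_r (r ^ 2)) at 2. apply Rmult_le_compat_l; [apply pow2_ge_0|lra].
Qed.

(** The coefficients after the first have square sum at most [1 - |a_0|^2], and the weights
    [r ^ (2 * m + 2)] sum to at most [r ^ 2 / (1 - r ^ 2)]. *)
Lemma majorant_le_parseval (f : unit_disc -> C) (a : nat -> C) (r : R) :
  Bclass f -> taylor f a -> 0 <= r < 1 ->
  Defs.majorant a r <= Cmod (a 0%nat)
     + r * (sqrt (1 - Cmod (a 0%nat) ^ 2) / sqrt (1 - r ^ 2)).
Proof.
  intros Hf Ha Hr.
  assert (Hx1 := Cmod_coef0_le_1 f a Hf Ha). assert (Hx0 := Cmod_ge_0 (a 0%nat)).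
  apply (majorant_le f); [assumption|lra|]. intros k.
  assert (W := sum_coef_sq_le_1 f a k Hf Ha). rewrite sum_tail in W.
  set (x := Cmod (a 0%nat)) in *.
  assert (G := sum_geom_le (r ^ 2) k ltac:(nra)).
  assert (CS := cauchy_schwarz_sum (fun m => Cmod (a (S m)) ^ 2)
     (fun m => (r ^ 2) ^ m * r ^ 2) (fun m => Cmod (a (S m)) * r ^ S m) k).
  rewrite <- (scal_sum (fun m => (r ^ 2) ^ m)) in CS.
  set (U := sum_f_R0 (fun m => Cmod (a (S m)) ^ 2) k) in *.
  set (V := sum_f_R0 (fun m => (r ^ 2) ^ m) k) in *.
  set (Z := sum_f_R0 (fun m => Cmod (a (S m)) * r ^ S m) k) in *.
  assert (CS' : Z ^ 2 <= U * (r ^ 2 * V)).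
  { assert (0 <= r ^ 2) by apply pow2_ge_0.
    apply CS; intros m.
    - apply pow2_ge_0.
    - apply Rmult_le_pos; [now apply pow_le|assumption].
    - apply Rmult_le_pos; [apply Cmod_ge_0|apply pow_le; lra].
    - apply Req_le. rewrite Rpow_mult_distr. simpl.
      rewrite !Rmult_1_r, Rpow_mult_distr. ring. }
  assert (Hr2 : 0 < 1 - r ^ 2) by nra.
  assert (Hs : 0 < sqrt (1 - r ^ 2)) by now apply sqrt_lt_R0.
  assert (Hs2 : sqrt (1 - r ^ 2) ^ 2 = 1 - r ^ 2) by (apply pow2_sqrt; lra).
  assert (Hc2 : sqrt (1 - x ^ 2) ^ 2 = 1 - x ^ 2) by (apply pow2_sqrt; nra).
  assert (HU : 0 <= U) by (apply cond_pos_sum; intros; apply pow2_ge_0).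
  assert (HV : 0 <= V) by (apply cond_pos_sum; intros; apply pow_le, pow2_ge_0).
  apply Rmult_le_reg_r with (sqrt (1 - r ^ 2)); [exact Hs|].
  replace (r * (sqrt (1 - x ^ 2) / sqrt (1 - r ^ 2)) * sqrt (1 - r ^ 2))
    with (r * sqrt (1 - x ^ 2)) by (field; lra).
  apply Rsqr_incr_0_var; [|apply Rmult_le_pos; [lra|apply sqrt_pos]].
  rewrite !Rsqr_pow2, !Rpow_mult_distr, Hs2, Hc2.
  apply Rle_trans with (r ^ 2 * (U * ((1 - r ^ 2) * V))).
  - apply Rle_trans with (U * (r ^ 2 * V) * (1 - r ^ 2)); [|apply Req_le; ring].
    apply Rmult_le_compat_r; lra.
  - apply Rmult_le_compat_l; [apply pow2_ge_0|].
    apply Rle_trans with (U * 1); [apply Rmult_le_compat_l; lra|]. lra.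
Qed.

(** * The functions [phi a] *)

Definition phi_coef (a : R) (n : nat) : C :=
  match n with
  | O => RtoC (- a)
  | S m => RtoC ((1 - a ^ 2) * a ^ m)
  end.

(** The bound is uniform in [a] and positive on the whole disc, even for [a = 1]. *)
Lemma phi_denominator_bound (a : R) (z : C) : 0 <= a <= 1 -> 1 - Cmod z <= Cmod (1 - a * z).
Proof.
  intros Ha.
  assert (H := Cmod_triangle (1 - a * z) (a * z)).
  replace (1 - a * z + a * z)%C with (RtoC 1) in H by ring.
  rewrite Cmod_1, Cmod_mult, Cmod_R, Rabs_right in H by lra.
  assert (H1 := Cmod_ge_0 z). nra.
Qed.

Lemma phi_denominator_neq0 (a : R) (z : C) : 0 <= a <= 1 -> Cmod z < 1 -> (1 - a * z)%C <> 0%C.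
Proof.
  intros Ha Hz E. assert (H := phi_denominator_bound a z Ha). rewrite E, Cmod_0 in H. lra.
Qed.

(** The partial sums have a closed form whose remainder is a bounded multiple of [z ^ (n + 1)]. *)
Lemma taylor_phi (a : R) : 0 <= a <= 1 -> taylor (phi a) (phi_coef a).
Proof.
  intros Ha [z Hz]. unfold phi; simpl proj1_sig.
  assert (Hden := phi_denominator_neq0 a z Ha Hz).
  assert (Hb := phi_denominator_bound a z Ha).
  assert (E : forall n, Csum (fun k => pow_n (K := C_AbsRing) z k * phi_coef a k)%C n
     = ((z - a) / (1 - a * z) - RtoC ((1 - a ^ 2) * a ^ n) * z ^ S n / (1 - a * z))%C).
  { induction n as [|n IH].
    - rewrite Csum_0. change (1 * RtoC (- a) = (z - a) / (1 - a * z) - RtoC ((1 - a ^ 2) * 1) * (z * 1) / (1 - a * z))%C.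
      rewrite RtoC_opp, RtoC_mult, RtoC_minus, RtoC_pow. field. exact Hden.
    - rewrite Csum_S, IH. unfold phi_coef.
      rewrite (pow_n_Cpow z (S n)).
      replace ((1 - a ^ 2) * a ^ S n) with (a * ((1 - a ^ 2) * a ^ n)) by (simpl; ring).
      rewrite (RtoC_mult a).
      rewrite (Cpow_S z (S n)). field. exact Hden. }
  assert (Hnum : forall n, Cmod (RtoC ((1 - a ^ 2) * a ^ n)) <= 1).
  { intros n. rewrite Cmod_R.
    assert (0 <= a ^ n <= 1) by (split; [apply pow_le|rewrite <- (pow1 n); apply pow_incr]; lra).
    assert (0 <= 1 - a ^ 2 <= 1) by nra.
    apply Rabs_le. split; nra. }
  apply filterlim_locally_ball_norm. intros eps.
  assert (Hz0 := Cmod_ge_0 z).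
  destruct (pow_lt_1_zero (Cmod z) ltac:(rewrite Rabs_right; lra) (eps * (1 - Cmod z))) as [N HN].
  { apply Rmult_lt_0_compat; [apply cond_pos|lra]. }
  exists N. intros n Hn.
  specialize (HN (S n) ltac:(lia)).
  rewrite Rabs_right in HN by (apply Rle_ge, pow_le; lra).
  change (Cmod (Csum (fun k => pow_n (K := C_AbsRing) z k * phi_coef a k)%C n
     - (z - a) / (1 - a * z))%C < eps).
  rewrite E.
  replace ((z - a) / (1 - a * z) - RtoC ((1 - a ^ 2) * a ^ n) * z ^ S n / (1 - a * z) - (z - a) / (1 - a * z))%C
    with (- (RtoC ((1 - a ^ 2) * a ^ n) * z ^ S n / (1 - a * z)))%C by ring.
  rewrite Cmod_opp, Cmod_div, Cmod_mult, Cmod_pow by exact Hden.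
  specialize (Hnum n). assert (H0 := Cmod_ge_0 (RtoC ((1 - a ^ 2) * a ^ n))).
  assert (Hp : 0 <= Cmod z ^ S n) by now apply pow_le.
  apply Rmult_lt_reg_r with (Cmod (1 - a * z)); [lra|].
  unfold Rdiv. rewrite Rmult_assoc, Rinv_l by lra.
  assert (He := cond_pos eps). nra.
Qed.

Lemma holomorphic_phi (a : R) : 0 <= a <= 1 -> holomorphic (phi a).
Proof.
  intros Ha z Hz.
  set (h := (1 - Cmod z) / 2).
  assert (Hh : 0 < h) by (unfold h; lra).
  assert (Hz0 := Cmod_ge_0 z).
  assert (Hden := phi_denominator_neq0 a z Ha Hz).
  assert (Hbz := phi_denominator_bound a z Ha).
  assert (Hext : forall w, Cmod w < 1 -> extend (phi a) w = ((w - a) / (1 - a * w))%C).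
  { intros w Hw. unfold extend. destruct (Rlt_dec (Cmod w) 1) as [k|k]; [reflexivity|lra]. }
  (* The derivative of [phi a] at [z]. *)
  exists (RtoC (1 - a ^ 2) / ((1 - a * z) * (1 - a * z)))%C.
  split; [apply is_linear_scal_l|].
  intros y Hy.
  rewrite <- (is_filter_lim_locally_unique (K := C_AbsRing) (V := AbsRing_NormedModule C_AbsRing) _ _ Hy).
  clear y Hy.
  intros eps.
  (* The bound [h] keeps [w] in the disc; [h ^ 3] pays for the three denominator factors, each at
     least [h], of the quadratic remainder. *)
  assert (Hd : 0 < Rmin h (eps * h ^ 3)).
  { apply Rmin_glb_lt; [exact Hh|]. apply Rmult_lt_0_compat; [apply cond_pos|now apply pow_lt]. }
  exists (mkposreal _ Hd). intros w Hw.
  change (Cmod (w - z)%C < Rmin h (eps * h ^ 3)) in Hw.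
  assert (Hw1 := Rlt_le_trans _ _ _ Hw (Rmin_l _ _)).
  assert (Hw2 := Rlt_le_trans _ _ _ Hw (Rmin_r _ _)).
  assert (Hwz : Cmod w <= Cmod z + h).
  { replace w with (z + (w - z))%C by ring. eapply Rle_trans; [apply Cmod_triangle|lra]. }
  assert (Hw' : Cmod w < 1) by (unfold h in *; lra).
  assert (Hbw := phi_denominator_bound a w Ha).
  assert (Hdenw := phi_denominator_neq0 a w Ha Hw').
  change (Cmod ((extend (phi a) w - extend (phi a) z)
     - (w - z) * (RtoC (1 - a ^ 2) / ((1 - a * z) * (1 - a * z))))%C <= eps * Cmod (w - z)%C).
  rewrite !Hext by assumption.
  replace ((w - a) / (1 - a * w) - (z - a) / (1 - a * z)
     - (w - z) * (RtoC (1 - a ^ 2) / ((1 - a * z) * (1 - a * z))))%C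
   with (RtoC (a * (1 - a ^ 2)) * ((w - z) * (w - z)) / ((1 - a * w) * ((1 - a * z) * (1 - a * z))))%C.
  2:{ rewrite RtoC_mult, RtoC_minus, RtoC_pow. field. split; assumption. }
  rewrite Cmod_div, !Cmod_mult, Cmod_R by (repeat apply Cmult_neq_0; assumption).
  assert (Hk : Rabs (a * (1 - a ^ 2)) <= 1) by (apply Rabs_le; nra).
  assert (Hk0 := Rabs_pos (a * (1 - a ^ 2))).
  set (K := Rabs (a * (1 - a ^ 2))) in *. set (d := Cmod (w - z)) in *.
  assert (Hd0 : 0 <= d) by apply Cmod_ge_0.
  set (p := Cmod (1 - a * w)) in *. set (q := Cmod (1 - a * z)) in *.
  assert (Hp : h <= p) by (unfold h in *; lra).
  assert (Hq : h <= q) by (unfold h in *; lra).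
  assert (Hden3 : h ^ 3 <= p * (q * q)).
  { simpl. rewrite Rmult_1_r. apply Rmult_le_compat; nra. }
  assert (Hh3 : 0 < h ^ 3) by now apply pow_lt.
  apply Rmult_le_reg_r with (p * (q * q)); [lra|].
  unfold Rdiv. rewrite Rmult_assoc, Rinv_l by lra.
  assert (He := cond_pos eps).
  assert (K * (d * d) <= d * (eps * h ^ 3)) by nra.
  assert (eps * d * h ^ 3 <= eps * d * (p * (q * q))) by
    (apply Rmult_le_compat_l; [apply Rmult_le_pos; lra|assumption]).
  lra.
Qed.

Lemma Bclass_phi (a : R) : 0 <= a <= 1 -> Bclass (phi a).
Proof.
  intros Ha. split; [now apply holomorphic_phi|].
  intros [z Hz]. unfold phi; simpl proj1_sig.
  assert (Hden := phi_denominator_neq0 a z Ha Hz).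
  assert (Hb := phi_denominator_bound a z Ha).
  rewrite Cmod_div by exact Hden.
  apply Rmult_le_reg_r with (Cmod (1 - a * z)); [lra|].
  unfold Rdiv. rewrite Rmult_assoc, Rinv_l, Rmult_1_l, Rmult_1_r by lra.
  apply Rsqr_incr_0_var; [|apply Cmod_ge_0]. rewrite !Rsqr_pow2.
  assert (Hz2 : Cmod z ^ 2 <= 1) by (assert (H := Cmod_ge_0 z); nra).
  rewrite Cmod2_alt in Hz2. rewrite !Cmod2_alt.
  (* This product is [|1 - a z|^2 - |z - a|^2]. *)
  assert (H : 0 <= (1 - a ^ 2) * (1 - (Re z ^ 2 + Im z ^ 2))) by (apply Rmult_le_pos; nra).
  destruct z as [u v]. unfold Re, Im in *; simpl in *. lra.
Qed.

(** A geometric series. The value is the bound of [majorant_le_large_coef0] at [|a_0| = a], which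
    makes [phi a] extremal there. *)
Lemma majorant_phi (a r : R) : 0 <= a <= 1 -> 0 <= r < 1 ->
  Defs.majorant (phi_coef a) r = a + (1 - a ^ 2) * r / (1 - a * r).
Proof.
  intros Ha Hr. apply is_series_unique. apply is_series_decr_1.
  assert (Hq : Rabs (a * r) < 1) by (apply Rabs_def1; nra).
  assert (G := is_series_scal ((1 - a ^ 2) * r) _ _ (is_series_geom (a * r) Hq)).
  match type of G with is_series _ ?l =>
    match goal with |- is_series _ ?l' => replace l' with l end end.
  - revert G. apply is_series_ext. intros n.
    change ((1 - a ^ 2) * r * (a * r) ^ n = Cmod (phi_coef a (S n)) * r ^ S n).
    unfold phi_coef. rewrite Cmod_R, Rabs_right, Rpow_mult_distr; [simpl; ring|].
    apply Rle_ge, Rmult_le_pos; [nra|apply pow_le; lra].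
  - change ((1 - a ^ 2) * r * / (1 - a * r)
      = a + (1 - a ^ 2) * r / (1 - a * r) + - (Cmod (RtoC (- a)) * 1)).
    rewrite Cmod_R, Rabs_Ropp, Rabs_right by lra. unfold Rdiv. ring.
Qed.

Lemma Upsilon_phi (a r : R) : 0 <= a <= 1 -> 0 <= r < 1 ->
  Upsilon (phi a) r = 1 - (a + (1 - a ^ 2) * r / (1 - a * r)).
Proof.
  intros Ha Hr. unfold Upsilon.
  rewrite (taylor_coefE _ _ (taylor_phi a Ha)), majorant_phi by assumption. reflexivity.
Qed.

Lemma Upsilon_phi_ge_0 (a r : R) : 0 <= a <= 1 -> 0 <= r <= 1 / 3 -> 0 <= Upsilon (phi a) r.
Proof.
  intros Ha Hr. rewrite Upsilon_phi by lra.
  (* In this factorization [r * (1 + 2 * a) <= 3 * r <= 1], which is where the radius [1 / 3]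
     enters. *)
  replace (1 - (a + (1 - a ^ 2) * r / (1 - a * r)))
    with ((1 - a) * (1 - r * (1 + 2 * a)) / (1 - a * r)) by (field; nra).
  apply Rmult_le_pos; [apply Rmult_le_pos; nra|]. left. apply Rinv_0_lt_compat. nra.
Qed.

(** Crude estimates suffice: the subtracted term is at most [1 / 2], while [1 - a >= 2 / 3]. *)
Lemma small_numerator_ge_0 (a r : R) : 0 <= a <= r -> r <= 1 / 3 ->
  0 <= 1 - a - r * (sqrt (1 - a ^ 2) / sqrt (1 - r ^ 2)).
Proof.
  intros Ha Hr.
  assert (Hs : 2 / 3 <= sqrt (1 - r ^ 2)).
  { rewrite <- (sqrt_Rsqr (2 / 3)) by lra. apply sqrt_le_1_alt. unfold Rsqr. nra. }
  assert (Hc : sqrt (1 - a ^ 2) <= 1) by (rewrite <- sqrt_1 at 2; apply sqrt_le_1_alt; nra).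
  assert (Hc0 := sqrt_pos (1 - a ^ 2)).
  assert (H : r * (sqrt (1 - a ^ 2) / sqrt (1 - r ^ 2)) <= 1 / 2); [|lra].
  apply Rmult_le_reg_r with (sqrt (1 - r ^ 2)); [lra|].
  replace (r * (sqrt (1 - a ^ 2) / sqrt (1 - r ^ 2)) * sqrt (1 - r ^ 2))
    with (r * sqrt (1 - a ^ 2)) by (field; lra). nra.
Qed.

(** * The sharp constant *)

Lemma quot_ge_0 (x y : R) : 0 <= x -> 0 <= y -> Rbar_le 0 (quot x y).
Proof.
  intros Hx Hy. unfold quot. destruct (Req_EM_T y 0) as [h|h]; [exact I|].
  simpl. apply Rmult_le_pos; [exact Hx|]. left. apply Rinv_0_lt_compat. lra.
Qed.

(** The convention [x / 0 = +oo] fits because for [y = 0] the right side reads [0 <= x]; hence the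
    need for nonnegative numerators. *)
Lemma le_quot_iff (lam x y : R) : 0 <= x -> 0 <= y ->
  Rbar_le lam (quot x y) <-> lam * y <= x.
Proof.
  intros Hx Hy. unfold quot. destruct (Req_EM_T y 0) as [h|h].
  - subst y. rewrite Rmult_0_r. split; intros _; [exact Hx|exact I].
  - simpl. assert (Hxy : x / y * y = x) by (field; exact h). split; intros H.
    + rewrite <- Hxy. now apply Rmult_le_compat_r.
    + apply Rmult_le_reg_r with y; lra.
Qed.

Lemma Rbar_glb_correct (E : Rbar -> Prop) : Rbar_is_glb E (Rbar_glb E).
Proof. unfold Rbar_glb. exact (proj2_sig (Rbar_ex_glb E)). Qed.

(** Reduces the sharp constant to showing that the admissible [lam] are exactly the nonnegative
    reals up to the infimum, which may be infinite. *)
Lemma is_lub_Rbar_le_trunc (E : R -> Prop) (L : Rbar) : Rbar_le 0 L ->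
  (forall x : R, E x <-> 0 <= x /\ Rbar_le x L) -> is_lub_Rbar E L.
Proof.
  intros HL HE. split.
  - intros x Hx. now apply HE.
  - intros b Hb. destruct L as [l| |]; [|destruct b as [b| |]|contradiction].
    + apply Hb, HE. split; [exact HL|apply Rle_refl].
    + assert (H : b < Rmax 0 (b + 1)) by (generalize (Rmax_r 0 (b + 1)); lra).
      assert (H' := Hb (Rmax 0 (b + 1)) (proj2 (HE _) (conj (Rmax_l _ _) I))). simpl in H'. lra.
    + exact I.
    + exact (Hb 0 (proj2 (HE 0) (conj (Rle_refl 0) I))).
Qed.

Theorem theorem2p2 (R0 : R) (vphi : (unit_disc -> C) -> R -> R)
  (hR0 : 0 <= R0 <= 1 / 3)
  (hvphi : nonneg_functional vphi)
  (hi : forall (f : unit_disc -> C) (a : nat -> C) (r : R),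
      0 <= r <= 1 / 3 -> Bclass f -> taylor f a ->
      vphi f r <= vphi (phi (Cmod (a 0%nat))) r)
  (hii : Rbar_le (inf_Upsilon vphi R0) (inf_small vphi R0)) :
  Lambda vphi R0 = inf_Upsilon vphi R0.
Proof.
  destruct (Rbar_glb_correct (fun x : Rbar => exists a s : R, 0 <= a <= 1 /\ 0 <= s <= R0 /\
      x = quot (Upsilon (phi a) s) (vphi (phi a) s))) as [inf_lb inf_glb].
  fold (inf_Upsilon vphi R0) in inf_lb, inf_glb.
  assert (vphi_ge_0 : forall a s, 0 <= a <= 1 -> 0 <= s <= R0 -> 0 <= vphi (phi a) s).
  { intros a s Ha Hs. apply hvphi; [now apply Bclass_phi|lra]. }
  apply is_lub_Rbar_unique, is_lub_Rbar_le_trunc.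
  { apply inf_glb. intros x [a [s [Ha [Hs ->]]]].
    apply quot_ge_0; [apply Upsilon_phi_ge_0; lra|now apply vphi_ge_0]. }
  intros lam. split; intros [Hlam H]; split; try exact Hlam.
  (* An admissible [lam] is tested on the functions [phi a] themselves. *)
  - apply inf_glb. intros x [a [s [Ha [Hs ->]]]].
    apply le_quot_iff; [apply Upsilon_phi_ge_0; lra|now apply vphi_ge_0|].
    assert (H' := H _ _ s (Bclass_phi a Ha) (taylor_phi a Ha) Hs).
    unfold Upsilon. rewrite (taylor_coefE _ _ (taylor_phi a Ha)). lra.
  - intros f a r Hf Ha Hr.
    assert (Hx0 := Cmod_ge_0 (a 0%nat)). assert (Hx1 := Cmod_coef0_le_1 f a Hf Ha).
    assert (Hv := hi f a r ltac:(lra) Hf Ha).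
    set (x := Cmod (a 0%nat)) in *.
    assert (Hv0 := vphi_ge_0 x r ltac:(lra) Hr).
    assert (Hle : lam * vphi f r <= lam * vphi (phi x) r) by now apply Rmult_le_compat_l.
    (* By [hi], [vphi f r] is already replaced by [vphi (phi x) r]; only the majorant of [f] remains
       to be bounded. *)
    destruct (Rlt_le_dec r x) as [Hrx|Hxr].
    + assert (HB := majorant_le_large_coef0 f a r Hf Ha ltac:(lra) Hrx). fold x in HB.
      assert (Hq : lam * vphi (phi x) r <= Upsilon (phi x) r).
      { apply le_quot_iff; [apply Upsilon_phi_ge_0; lra|exact Hv0|].
        eapply Rbar_le_trans; [exact H|]. apply inf_lb. exists x, r. now repeat split; try lra. }
      rewrite Upsilon_phi in Hq by lra. lra.
    + assert (HB := majorant_le_parseval f a r Hf Ha ltac:(lra)). fold x in HB.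
      assert (Hq : lam * vphi (phi x) r <= 1 - x - r * (sqrt (1 - x ^ 2) / sqrt (1 - r ^ 2))).
      { apply le_quot_iff; [apply small_numerator_ge_0; lra|exact Hv0|].
        (* Here [x <= r], so [lam] lies below [inf_small] by [hii], then below the inner infimum at
           [r] and its member at [x]. *)
        eapply Rbar_le_trans; [exact H|]. eapply Rbar_le_trans; [exact hii|].
        eapply Rbar_le_trans.
        - apply (proj1 (Rbar_glb_correct _)). exists r. split; [exact Hr|reflexivity].
        - apply (proj1 (Rbar_glb_correct _)). exists x. split; [lra|reflexivity]. }
      lra.
Qed.
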